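(* There is a constant $C$ such that the following holds. Let $n$ be a sufficiently large positive integer and let $A$ be a subset of $\mathbb{Z}_n$ with $|A| \ge C n^{1/2}$ such that every element of $A$ is co-prime with $n$. Then $A$ is complete, i.e. $S_A = \mathbb{Z}_n$.
   Context: $\mathbb{Z}_n$ denotes the (additive) cyclic group of order $n$, i.e. the integers modulo $n$. An element of $\mathbb{Z}_n$ is co-prime with $n$ if an (equivalently, any) integer representing it is co-prime to $n$. For a subset $A$ of an additive group $G$, $S_A$ denotes the collection of subset sums of $A$: $S_A = \{\sum_{x\in B} x \mid B \subset A, |B| < \infty\}$. The set $A$ is called complete (with respect to $G$) if $S_A = G$. The elements of a set are distinct (no repetitions). The constant $C$ is absolute (independent of $n$ and $A$). *)

(* Defs.v *)
From HB Require Import structures.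
From mathcomp Require Import all_boot all_order all_algebra.

Set Implicit Arguments.
Unset Strict Implicit.
Unset Printing Implicit Defensive.

Import GRing.Theory.
Local Open Scope ring_scope.

Definition subset_sums (G : finZmodType) (A : {set G}) : {set G} :=
  [set \sum_(x in B) x | B : {set G} & B \subset A].

Definition complete (G : finZmodType) (A : {set G}) : Prop :=
  subset_sums A = [set: G].

(* Main.v *)
Require Import Defs.
From HB Require Import structures.
From mathcomp Require Import all_boot all_order all_algebra.
From mathcomp Require Import reals.
From mathcomp Require Import zify.

(** The proof is the Erdos-Heilbronn greedy argument for subset sums, with
    Chowla's theorem in the place of the Cauchy-Davenport theorem.

    Elements of Z_n that are coprime with n are exactly the generators of Z_n,
    and generation is all that is used: the argument runs in any finite abelian
    group G.  The first ingredient is Chowla's theorem ([chowla]): adding a set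
    made of 0 and of l generators enlarges a set by at least l, until G is
    filled.  Hence the m-fold sumset of [0 |: A] has at least
    [minn #|G| (m * #|A| + 1)] elements.

    The second ingredient is the gain of a translation: the number of points
    of B that a translation by a moves out of B, which is also the number of
    points that [B + a] adds to B.  The gain is subadditive in a, and its
    average over a set T with at least 2|B| elements is at least |B|/2.  Take
    for T the m-fold sumset of [0 |: A], with m about 2|B|/|A|: if every element
    of A had gain below |A|/6, subadditivity would make the gain too small on
    all of T.  So, as long as |A| <= |B| <= |G|/2, some element of A has gain at
    least |A|/6 ([exists_large_gain]).

    Now let L be a sixth of |A|.  From 3L elements of A, put L aside, whose
    subset sums are at least L in number, then add L others one at a time,
    chosen greedily among the at least L that remain.  Every step gains L/6, so
    when L^2 >= 3|G| the subset sums fill more than half of G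
    ([subset_sums_more_than_half]).  Do this on two disjoint parts of A: by the
    pigeonhole principle, every element of G is the sum of a subset sum of the
    first part and a subset sum of the second. *)

Set Implicit Arguments.
Unset Strict Implicit.
Unset Printing Implicit Defensive.

Import Order.TTheory GRing.Theory Num.Theory.
Local Open Scope ring_scope.

(** * Sumsets and Chowla's theorem *)

Section Sumsets.

Variable G : finZmodType.
Implicit Types (A B S T : {set G}) (a b x y : G).

Definition sumset A B : {set G} := [set x + y | x in A, y in B].

Definition generates a : Prop := forall x, exists k : nat, x = a *+ k.

Lemma mem_sumset A B x y : x \in A -> y \in B -> x + y \in sumset A B.
Proof. by move=> xA yB; apply/imset2P; exists x y. Qed.

Lemma generates_closed_setT a A x :
  generates a -> x \in A -> (forall y, y \in A -> y + a \in A) -> A = [set: G].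
Proof.
move=> ga xA clA; apply/setP => y; rewrite inE.
have [k yE] := ga (y - x).
have -> : y = x + a *+ k by rewrite -yE addrCA subrr addr0.
elim: k {y yE} => [|k IHk]; first by rewrite mulr0n addr0.
by rewrite mulrSr addrA; apply: clA.
Qed.

(** The proof is by Davenport's transform.  If some [a + b] falls outside A, add
    [a + B] to A and keep in B only the b with [a + b] in A: the sum of the
    cardinals is unchanged, the sumset does not grow, and B shrinks while still
    containing 0.  Otherwise A is stable by every element of B, and a generator
    in B forces A to be the whole group. *)
Theorem chowla A B :
  A != set0 -> 0 \in B -> (forall b, b \in B -> b != 0 -> generates b) ->
  (minn #|G| (#|A| + #|B|.-1) <= #|sumset A B|)%N.
Proof.
have [N] := ubnP #|B|; elim: N => // N IHN in A B *.
rewrite ltnS => leBN A0 B0 genB.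
have sub_sumset : A \subset sumset A B.
  by apply/subsetP => x xA; rewrite -[x]addr0; apply: mem_sumset.
case: (set_0Vmem (B :\ 0)) => [B1 | [b]].
  have -> : #|B| = 1%N by rewrite (cardsD1 0) B0 B1 cards0.
  by rewrite addn0 geq_min (subset_leq_card sub_sumset) orbT.
rewrite !inE => /andP [nzb bB].
case: (boolP [exists a in A, exists c in B, a + c \notin A]); last first.
  move=> stable; have [x xA] := set0Pn _ A0.
  have AT : A = [set: G].
    apply: (generates_closed_setT (genB _ bB nzb) xA) => y yA.
    apply/negPn; apply: contra stable => yb.
    by apply/exists_inP; exists y => //; apply/exists_inP; exists b.
  by rewrite geq_min -cardsT -AT (subset_leq_card sub_sumset).
move=> /exists_inP [a aA /exists_inP [c cB acA]].
pose aB := [set a + x | x in B].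
pose A' := A :|: aB; pose B' := [set x in B | a + x \in A].
have ltB'B : (#|B'| < #|B|)%N.
  apply: proper_card; apply/properP; split.
    by apply/subsetP => x; rewrite inE => /andP [].
  by exists c => //; rewrite inE cB.
have B'0 : 0 \in B' by rewrite inE B0 addr0.
have card_sum : (#|A'| + #|B'| = #|A| + #|B|)%N.
  have -> : #|B'| = #|A :&: aB|.
    rewrite -(card_imset _ (addrI a)); apply: eq_card => y.
    apply/imsetP/setIP => [[x] | [yA /imsetP [x xB yE]]].
      by rewrite inE => /andP [xB axA] ->; split=> //; apply: imset_f.
    by exists x => //; rewrite inE xB -yE.
  by rewrite cardsUI card_imset //; apply: addrI.
have sub' : sumset A' B' \subset sumset A B.
  apply/subsetP => _ /imset2P [x y xA' + ->]; rewrite inE => /andP [yB ayA].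
  case/setUP: xA' => [xA | /imsetP [z zB ->]]; first exact: mem_sumset.
  by rewrite addrAC; apply: mem_sumset.
have A'0 : A' != set0 by apply/set0Pn; exists a; rewrite inE aA.
have B'gt0 : (0 < #|B'|)%N by apply/card_gt0P; exists 0.
apply: leq_trans (subset_leq_card sub').
have -> : (#|A| + #|B|.-1 = #|A'| + #|B'|.-1)%N by lia.
apply: IHN => //; first exact: leq_trans ltB'B leBN.
by move=> x; rewrite inE => /andP [xB _]; apply: genB.
Qed.

Lemma card_iter_sumset A m :
    0 \notin A -> (forall a, a \in A -> generates a) ->
  (minn #|G| (m * #|A|).+1 <= #|iter m (sumset^~ (0%R |: A)) [set 0%R]|)%N.
Proof.
move=> A0 genA; elim: m => [|m IHm] /=; first by rewrite cards1 geq_minr.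
set T := iter m _ _ in IHm *.
have Gpos : (0 < #|G|)%N by apply/card_gt0P; exists 0.
have T0 : T != set0 by rewrite -card_gt0; apply: leq_trans IHm; rewrite leq_min Gpos.
have := @chowla T (0 |: A) T0.
rewrite setU11 cardsU1 A0 => /(_ isT) ch.
apply: leq_trans (ch _); first by move: IHm; rewrite mulSn /=; lia.
by move=> b /setU1P [->|/genA //]; rewrite eqxx.
Qed.

(** * The gain of a translation *)

Definition gain B a : nat := #|[set x in B | x + a \notin B]|.

Lemma gain0 B : gain B 0 = 0%N.
Proof.
apply/eqP; rewrite cards_eq0; apply/eqP/setP => x.
by rewrite !inE addr0 andbN.
Qed.

(** A point that leaves B under [a + b] leaves B either under a, or later,
    from its image by a, under b. *)
Lemma gainD B a b : (gain B (a + b)%R <= gain B a + gain B b)%N.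
Proof.
rewrite /gain -(card_imset [set x in B | x + (a + b) \notin B] (addIr a)).
rewrite -(card_imset [set x in B | x + a \notin B] (addIr a)).
apply: leq_trans (leq_card_setU _ _); apply/subset_leq_card/subsetP => y.
case/imsetP => x; rewrite !inE => /andP [xB xab] ->.
case: (boolP (x + a \in B)) => xaB; last by rewrite (imset_f (+%R^~ a)) // inE xB.
by rewrite -addrA xab orbT.
Qed.

Lemma gain_iter_sumset B A M m x :
    (forall a, a \in A -> (gain B a <= M)%N) ->
  x \in iter m (sumset^~ (0 |: A)) [set 0] -> (gain B x <= m * M)%N.
Proof.
move=> leM; elim: m x => [|m IHm] x /=; first by rewrite inE => /eqP ->; rewrite gain0.
case/imset2P => y z /IHm ley /setU1P zA ->.
apply: leq_trans (gainD _ _ _) _; rewrite mulSn addnC leq_add //.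
by case: zA => [-> | /leM //]; rewrite gain0.
Qed.

(** Double counting: for a fixed x in B, at most |B| of the translations keep
    x inside B. *)
Lemma leq_sum_gain B T :
  (#|B| * #|T| <= #|B| * #|B| + \sum_(t in T) gain B t)%N.
Proof.
have -> : (\sum_(t in T) gain B t = \sum_(x in B) #|[set t in T | (x + t)%R \notin B]|)%N.
  under eq_bigr => t _ do rewrite /gain -sum1_card (eq_bigl _ _ (in_set _)) big_mkcondr.
  rewrite exchange_big; apply: eq_bigr => x _.
  by rewrite -big_mkcondr -sum1_card; apply: eq_bigl => t; rewrite inE.
rewrite -!sum_nat_const -big_split; apply: leq_sum => x _.
rewrite -[leqLHS](cardsID [set t | x + t \in B]) leq_add //.
  rewrite -(card_imset (T :&: _) (addrI x)).
  by apply/subset_leq_card/subsetP => _ /imsetP [t + ->]; rewrite !inE => /andP [].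
by apply/subset_leq_card/subsetP => t; rewrite !inE andbC.
Qed.

(** The number of summands m is chosen so that the m-fold sumset T of [0 |: A]
    has at least 2|B| elements; then |B|/2 <= m M on average over T, where M
    bounds the gains on A, while m <= 3|B|/|A|. *)
Lemma exists_large_gain A B :
    (0 < #|A| <= #|B|)%N -> (2 * #|B| <= #|G|)%N -> 0 \notin A ->
    (forall a, a \in A -> generates a) ->
  exists2 a, a \in A & (#|A| <= 6 * gain B a)%N.
Proof.
move=> /andP [Apos leAB] leBG A0 genA.
case: (boolP [exists a in A, (#|A| <= 6 * gain B a)%N]).
  by move=> /exists_inP [a]; exists a.
move=> small; exfalso.
(* M is the largest integer with 6 M < |A|. *)
pose M := (#|A|.-1 %/ 6)%N; pose m := (2 * #|B| %/ #|A|).+1.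
have leM a : a \in A -> (gain B a <= M)%N.
  move=> aA; rewrite leq_divRL //; move: small; rewrite negb_exists_in.
  by move=> /forall_inP /(_ a aA); lia.
have ltM : (6 * M < #|A|)%N by have := leq_divM #|A|.-1 6; rewrite -/M; lia.
have [ltm lem] : (2 * #|B| < m * #|A|)%N /\ (m * #|A| <= 2 * #|B| + #|A|)%N.
  split; first exact: ltn_ceil.
  by rewrite /m mulSn addnC leq_add2r leq_divM.
have := card_iter_sumset m A0 genA.
set T := iter m _ _ => cardT.
have leT : (2 * #|B| <= #|T|)%N by apply: leq_trans cardT; rewrite leq_min leBG; lia.
have sumT : (\sum_(t in T) gain B t <= #|T| * (m * M))%N.
  rewrite -sum_nat_const; apply: leq_sum => t; exact: gain_iter_sumset.
have BT := leq_sum_gain B T.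
have BleM : (#|B| <= 2 * (m * M))%N.
  rewrite -(@leq_pmul2l #|T|); last by lia.
  have : (2 * (#|B| * #|B|) <= #|B| * #|T|)%N by rewrite mulnCA leq_mul2l leT orbT.
  by lia.
have : (m * (6 * M) < m * #|A|)%N by rewrite ltn_pmul2l.
by lia.
Qed.

(** * Growth of the set of subset sums *)

Lemma subset_sumsD A B x y : [disjoint A & B] ->
  x \in subset_sums A -> y \in subset_sums B -> x + y \in subset_sums (A :|: B).
Proof.
move=> dAB /imsetP [U + ->] /imsetP [V + ->]; rewrite !inE => sUA sVB.
have dUV : [disjoint U & V] by apply: disjointW dAB.
rewrite -bigU // (eq_bigl (mem (U :|: V))); last by move=> z; rewrite !inE.
by apply: imset_f; rewrite inE setUSS.
Qed.

Lemma subset_sumsS A B : A \subset B -> subset_sums A \subset subset_sums B.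
Proof.
move=> sAB; apply/subsetP => _ /imsetP [U + ->]; rewrite inE => sUA.
by apply: imset_f; rewrite inE (subset_trans sUA).
Qed.

Lemma mem_subset_sums A x : x \in A -> x \in subset_sums A.
Proof.
move=> xA; rewrite -[x](big_set1 +%R x (fun y => y)).
by apply: imset_f; rewrite inE sub1set.
Qed.

Lemma card_subset_sumsU1 A a : a \notin A ->
  (#|subset_sums A| + gain (subset_sums A) a <= #|subset_sums (a |: A)|)%N.
Proof.
move=> aA; set S := subset_sums A.
pose new := [set x + a | x in [set x in S | x + a \notin S]].
have -> : gain S a = #|new| by rewrite card_imset //; apply: addIr.
have disj : [disjoint S & new].
  rewrite disjoint_sym; apply/pred0P => y /=; apply/negP => /andP [/imsetP [x + ->] yS].
  by rewrite inE yS andbF.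
have := (leq_card_setU S new).2; rewrite disj => /eqP <-.
apply/subset_leq_card/subsetP => y /setUP [yS | /imsetP [x + ->]].
  by apply: subsetP yS; apply: subset_sumsS; apply: subsetUr.
rewrite inE addrC => /andP [xS _]; apply: subset_sumsD => //.
  by rewrite disjoints1.
by apply: mem_subset_sums; rewrite inE.
Qed.

(** The greedy procedure: s elements of A1 are moved to A0 one by one, and at
    each step the at least L remaining ones contain an element of gain L/6. *)
Lemma greedy_growth L s A0 A1 :
    (0 < L)%N -> [disjoint A0 & A1] -> (L + s <= #|A1|)%N ->
    0 \notin A1 -> (forall a, a \in A1 -> generates a) ->
    (L <= #|subset_sums A0|)%N ->
  (#|G| < 2 * #|subset_sums (A0 :|: A1)|)%N \/
  (6 * #|subset_sums A0| + L * s <= 6 * #|subset_sums (A0 :|: A1)|)%N.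
Proof.
move=> Lpos; elim: s => [|s IHs] in A0 A1 * => disj leA1 nzA1 genA1 leS;
  have mono := subset_leq_card (subset_sumsS (subsetUl A0 A1)).
  by right; rewrite muln0 addn0 leq_mul2l.
have [big | small] := ltnP #|G| (2 * #|subset_sums A0|).
  by left; apply: leq_trans big _; rewrite leq_mul2l.
have [D sDA cardD] : exists2 D : {set G}, D \subset A1 & #|D| = L.
  have leLA : (L <= #|A1|)%N by lia.
  have : (0 < 'C(#|A1|, L))%N by rewrite bin_gt0.
  rewrite -cards_draws => /card_gt0P [D]; rewrite inE => /andP [sDA /eqP cardD].
  by exists D.
have [||||a aD] := @exists_large_gain D (subset_sums A0).
- by rewrite cardD Lpos.
- exact: small.
- by apply: contra nzA1; apply: (subsetP sDA).
- by move=> a /(subsetP sDA); apply: genA1.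
rewrite cardD => large; have aA1 := subsetP sDA _ aD.
have aA0 : a \notin A0 by rewrite (disjointFl disj).
have grow := card_subset_sumsU1 aA0.
have -> : A0 :|: A1 = (a |: A0) :|: (A1 :\ a).
  by rewrite setUAC setD1K // setUC.
have [||||||] := IHs (a |: A0) (A1 :\ a).
- rewrite -setI_eq0; apply/eqP/setP => x; rewrite !inE.
  case: eqVneq => //= _; apply/negP => /andP [xA0].
  by rewrite (disjointFr disj xA0).
- by move: leA1; rewrite (cardsD1 a A1) aA1; lia.
- by apply: contra nzA1; rewrite inE => /andP [].
- by move=> x; rewrite inE => /andP [_]; apply: genA1.
- by lia.
- by left.
by right; lia.
Qed.

Lemma split_card A k : (k <= #|A|)%N ->
  exists U V : {set G},
    [/\ A = U :|: V, [disjoint U & V], #|U| = k & #|V| = (#|A| - k)%N].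
Proof.
rewrite -bin_gt0 -cards_draws => /card_gt0P [U]; rewrite inE => /andP [sUA /eqP cU].
exists U, (A :\: U); split=> //.
- by rewrite -{1}(setID A U) (setIidPr sUA).
- by rewrite disjoint_sym disjoints_subset setDE subsetIr.
by rewrite cardsDS // cU.
Qed.

(** L elements set aside give at least L subset sums, and L greedy steps among
    the others bring six times this number to at least 6 L + L^2 > 3 |G|. *)
Lemma subset_sums_more_than_half L A :
    (0 < L)%N -> (3 * #|G| <= L ^ 2)%N -> (3 * L <= #|A|)%N ->
    0 \notin A -> (forall a, a \in A -> generates a) ->
  (#|G| < 2 * #|subset_sums A|)%N.
Proof.
move=> Lpos leGL leLA nzA genA.
have [|U [V [defA disj cardU cardV]]] := @split_card A L; first by lia.
have leLS : (L <= #|subset_sums U|)%N.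
  by rewrite -cardU; apply/subset_leq_card/subsetP => x; apply: mem_subset_sums.
have sVA : V \subset A by rewrite defA subsetUr.
have [||||big|] // := @greedy_growth L L U V Lpos disj.
- by lia.
- by apply: contra nzA; apply: (subsetP sVA).
- by move=> a /(subsetP sVA); apply: genA.
- by rewrite defA.
by rewrite defA; lia.
Qed.

(** Pigeonhole: S and [x - T] are too large to be disjoint. *)
Lemma sum_of_large_sets S T x :
  (#|G| < #|S| + #|T|)%N -> exists2 y, y \in S & x - y \in T.
Proof.
move=> large; pose T' := [set x - t | t in T].
have cardT' : #|T'| = #|T| by rewrite card_imset // => u v /addrI /oppr_inj.
have [disj | ] := boolP [disjoint S & T'].
  have := (leq_card_setU S T').2; rewrite disj => /eqP cardU.
  by have := max_card (S :|: T'); rewrite cardU cardT' leqNgt large.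
case/pred0Pn => y /= /andP [yS /imsetP [t tT yE]].
by exists y; rewrite // yE subKr.
Qed.

Lemma complete_of_generators L A :
    (0 < L)%N -> (3 * #|G| <= L ^ 2)%N -> (6 * L <= #|A|)%N ->
    0 \notin A -> (forall a, a \in A -> generates a) ->
  complete A.
Proof.
move=> Lpos leGL leLA nzA genA.
have [|U [V [defA disj cardU cardV]]] := @split_card A (3 * L); first by lia.
have large (W : {set G}) : W \subset A -> (3 * L <= #|W|)%N -> (#|G| < 2 * #|subset_sums W|)%N.
  move=> sWA leLW; apply: (@subset_sums_more_than_half L) => //.
    by apply: contra nzA; apply: (subsetP sWA).
  by move=> a /(subsetP sWA); apply: genA.
have [sUA sVA] : U \subset A /\ V \subset A by rewrite defA subsetUl subsetUr.
apply/setP => x; rewrite inE.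
have [|y yU xyV] := @sum_of_large_sets (subset_sums U) (subset_sums V) x.
  have := large U sUA; have := large V sVA; lia.
by rewrite -[x](subrKC y) defA; apply: subset_sumsD.
Qed.

End Sumsets.

(** * Integers modulo n *)

Lemma coprime_generates n (x : 'Z_n) : (1 < n)%N -> coprime x n -> generates x.
Proof.
move=> n_gt1 co y.
have ux : x \is a GRing.unit by rewrite -[x]natr_Zp unitZpE // coprime_sym.
by exists (x^-1 * y : 'Z_n); rewrite -mulr_natr natr_Zp mulVKr.
Qed.

(** With L = |A| / 6 rounded down, |A| < 12 L, so |A|^2 >= 432 n is what the
    condition L^2 >= 3 n of [complete_of_generators] asks for; and
    21^2 = 441. *)
Theorem theorem1p2 (R : realType) :
  exists C : R, exists n0 : nat, forall n : nat,
    (1 < n)%N -> (n0 <= n)%N ->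
    forall A : {set 'Z_n},
      C * Num.sqrt n%:R <= #|A|%:R ->
      (forall x : 'Z_n, x \in A -> coprime x n) ->
      complete A.
Proof.
exists 21, 0 => n n_gt1 _ A leA coA.
have cardG : #|'Z_n| = n by rewrite card_ord Zp_cast.
have leA2 : (441 * n <= #|A| ^ 2)%N.
  rewrite -(ler_nat R) natrM natrX -[n%:R]sqr_sqrtr ?ler0n //.
  have -> : 441%:R = 21 ^+ 2 :> R by rewrite -natrX.
  by rewrite -exprMn lerXn2r // nnegrE ?ler0n // mulr_ge0 ?sqrtr_ge0.
pose L := (#|A| %/ 6)%N.
have [leLA ltAL] : (6 * L <= #|A|)%N /\ (#|A| < 6 * L + 6)%N by rewrite /L; lia.
have Lpos : (0 < L)%N by nia.
apply: (@complete_of_generators _ L) => //.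
- by rewrite cardG; nia.
- by apply/negP => /coA; rewrite /coprime gcd0n; lia.
- by move=> x /coA; apply: coprime_generates.
Qed.
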